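(* Given two events $A$ and $C$, with $AC\neq\emptyset$, it holds that $\mathbb{P}[A|((C|A)\wedge C)]\geq P(A)$.
   Context: Events. An event is a two-valued (true/false) logical entity, identified with its $0/1$ indicator; $\Omega$ and $\emptyset$ are the sure and impossible events, $AB$ denotes $A\wedge B$, and $\overline{A}$ is the negation of $A$. The constituents generated by finitely many events are the non-impossible conjunctions obtained by choosing each event or its negation. An event $E$ is identified with $E|\Omega$. Conditional random quantities. For an event $H\neq\emptyset$ and a finite-valued random quantity $X$ with assessed prevision $\mathbb{P}(X|H)=\mu$, the conditional random quantity $X|H$ is $X|H=XH+\mu\overline{H}$. When $X$ is (the indicator of) an event $A$, $\mathbb{P}(A|H)=P(A|H)$ and $A|H$ is the (indicator of the) conditional event, with values $1$, $0$, $P(A|H)$ according to whether $AH$, $\overline{A}H$, $\overline{H}$ is true. Conjunction. The conjunction $(E_1|H_1)\wedge\cdots\wedge(E_n|H_n)$ is the conditional random quantity, with conditioning event $H_1\vee\cdots\vee H_n$, taking value $1$ if all $E_iH_i$ are true, $0$ if some $\overline{E}_iH_i$ is true, $x_S$ if $(\bigwedge_{i\in S}\overline{H}_i)\wedge(\bigwedge_{i\notin S}E_iH_i)$ is true ($\emptyset\ne S\subsetneq\{1,\dots,n\}$), where $x_S$ is the prevision of $\bigwedge_{i\in S}(E_i|H_i)$, and its own prevision if all $H_i$ are false. Generalized iterated conditional. If $\mathcal{C}_n=(E_1|H_1)\wedge\cdots\wedge(E_n|H_n)$ is not identically $0$, then $(E_{n+1}|H_{n+1})|\mathcal{C}_n$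 is the random quantity $\mathcal{C}_n\wedge(E_{n+1}|H_{n+1})+\mu(1-\mathcal{C}_n)$, where $\mu$ is its own prevision. In the present case, with $x=P(C|A)$: $(C|A)\wedge C$ has values $1$ on $AC$, $x$ on $\overline{A}C$, $0$ on $\overline{C}$; $A\wedge(C|A)\wedge C=AC$; and $A|((C|A)\wedge C)=AC+\mu(1-(C|A)\wedge C)$ has values $1$ on $AC$, $\mu(1-x)$ on $\overline{A}C$, $\mu$ on $\overline{C}$, with $\mu=\mathbb{P}[A|((C|A)\wedge C)]$. Coherence. A bet on an object $Z$ with assessed prevision $\mu$ and stake $s\in\mathbb{R}$ has random gain $s(Z-\mu)$. The bet is called off in a constituent if there one receives back the paid amount $\mu$ whatever the value of $\mu$ (for $X|H$: when $\overline{H}$ is true; for a generalized iterated conditional this may depend on the preliminary probability values, e.g. on whether $x=0$). An assessment of previsions is coherent if, for every finite subfamily of objects and all real stakes, the total gain $G$, restricted to the constituents in which not all the bets are called off, satisfies $\min G\le 0\le\max G$. Coherent previsions are linear. All probabilities and previsions are assumed to come from a coherent assessment on all objects involved. *)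

(* Defs.v *)
From mathcomp Require Import all_boot all_order all_algebra.
From mathcomp Require Import reals.

Set Implicit Arguments.
Unset Strict Implicit.
Unset Printing Implicit Defensive.

Import Order.TTheory GRing.Theory Num.Theory.
Local Open Scope ring_scope.

(* [T] is a type of elementary cases.  The constituents generated by finitely
   many events are the nonempty classes of points on which these events have
   the same truth values; [T] itself need not be finite. *)
Definition event (T : Type) := pred T.

Definition sure {T : Type} : event T := xpredT.

Definition possible (T : Type) (E : event T) : Prop := exists w, E w.

(* [CondEvent E H] is the conditional event [E|H].  The condition [possible H]
   is not built in: if [H] is impossible, then [E|H] is constantly equal to its
   own prevision, and a bet on it is called off everywhere. *)
Record condEvent (T : Type) := CondEvent { csq : event T ; ant : event T }.

Definition of_event (T : Type) (E : event T) : condEvent T := CondEvent E sure.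

(* The objects of bets: the conjunction of [E_1|H_1], ..., [E_n|H_n], which for
   [n = 1] is the conditional event itself, and the generalized iterated
   conditional [Iter e l = e | C_n], with [C_n] the conjunction of [l].  The
   latter is meant for [C_n] not identically [0]; this depends on the previsions
   of the subconjunctions of [l], hence cannot be a condition on [l]. *)
Inductive object (T : Type) :=
  | Conj (l : seq (condEvent T))
  | Iter (e : condEvent T) (l : seq (condEvent T)).

Section Assessment.
Context {R : realType} {T : Type}.
Implicit Types (P : object T -> R) (l : seq (condEvent T)) (mu : R) (w : T).

(* The third case is [x_S], where [S] is the set of those [i] with [H_i] false
   at [w].  The prevision [mu] of the conjunction itself is kept as an argument,
   in order to express below when a bet is called off. *)
Definition conj_value P l mu w : R :=
  if all (fun e => csq e w && ant e w) l then 1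
  else if has (fun e => ~~ csq e w && ant e w) l then 0
  else if has (fun e => ant e w) l then
    P (Conj [seq e <- l | ~~ ant e w])
  else mu.

Definition conj_rq P l w : R := conj_value P l (P (Conj l)) w.

Definition value P (o : object T) mu w : R :=
  match o with
  | Conj l => conj_value P l mu w
  | Iter e l => conj_rq P (rcons l e) w + mu * (1 - conj_rq P l w)
  end.

(* All previsions other than that of [o] being those of [P], the paid amount
   is received back at [w] whatever it is. *)
Definition called_off P (o : object T) w : Prop :=
  forall mu, value P o mu w = mu.

Definition gain P n (o : 'I_n -> object T) (s : 'I_n -> R) w : R :=
  \sum_(i < n) s i * (value P (o i) (P (o i)) w - P (o i)).

(* The assessment is the restriction of [P] to the family [K] of objects.  The
   gain is constant on each of the finitely many constituents, so it attains its
   minimum (at [w1]) and its maximum (at [w2]) over the cases where some bet is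
   not called off. *)
Definition coherent (K : object T -> Prop) P : Prop :=
  forall n (o : 'I_n -> object T) (s : 'I_n -> R),
    (forall i, K (o i)) ->
    let active w := exists i, ~ called_off P (o i) w in
    (exists w, active w) ->
    exists w1 w2,
      [/\ active w1, active w2,
          forall w, active w -> gain P o s w1 <= gain P o s w <= gain P o s w2
        & gain P o s w1 <= 0 <= gain P o s w2].

(* The values of [(C|A) /\ C] and of [A|((C|A) /\ C)]. *)
Fact conj_cond_event_rq P (A C : event T) w :
  conj_rq P [:: CondEvent C A; of_event C] w =
    if C w then (if A w then 1 else P (Conj [:: CondEvent C A])) else 0.
Proof.
by rewrite /conj_rq /conj_value /=; case: (A w); case: (C w).
Qed.

Fact iter_cond_event_value P (A C : event T) mu w :
  let x := P (Conj [:: CondEvent C A]) in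
  value P (Iter (of_event A) [:: CondEvent C A; of_event C]) mu w =
    if C w then (if A w then 1 else mu * (1 - x)) else mu.
Proof.
rewrite /= conj_cond_event_rq /conj_rq /conj_value /=.
by case: (A w); case: (C w); rewrite /= ?subrr ?subr0 ?mulr0 ?mulr1 ?addr0 ?add0r.
Qed.

End Assessment.

(* Main.v *)
Require Import Defs.
From mathcomp Require Import all_boot all_order all_algebra.
From mathcomp Require Import reals.
From mathcomp Require Import lra.

Set Implicit Arguments.
Unset Strict Implicit.
Unset Printing Implicit Defensive.

Import Order.TTheory GRing.Theory Num.Theory.
Local Open Scope ring_scope.

(** Write [a = P(A)], [x = P(C|A)] and [mu] for the prevision of
    [A|((C|A) /\ C)].  If previsions are regarded as expectations, then
    [P(AC) = a x], and the fair bet on the iterated conditional, whose gain is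
    [1 - mu] on [AC], [- mu x] on [~A C] and [0] on [~C], gives
    [a x (1 - mu) = P(~A C) mu x].  For [x > 0] this simplifies to
    [a (1 - mu) = P(~A C) mu <= (1 - a) mu], that is, [a <= mu].

    Coherence only speaks of stakes, so this computation is turned into a
    combination of bets: if [0 <= mu < a] and [0 < x], then the stakes [- x]
    on [A], [- (1 - mu)] on [C|A] and [1] on the iterated conditional win in
    every case.  The bounds [0 <= a <= 1], [0 <= x <= 1] and [0 <= mu] come
    from single bets ([cond_event_prevision_itv], [iter_prevision_ge0]).

    For [x = 0] the bet on the iterated conditional is called off outside
    [AC], which forces [mu = 1] ([iter_prevision_eq1]), and [a <= 1] is
    enough. *)

Section Coherence.
Context {R : realType} {T : Type}.
Context (K : object T -> Prop) (P : object T -> R) (hP : coherent K P).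

(** The case of a single bet with unit stake: a coherent prevision lies between
    two values taken where the bet stands. *)
Lemma coherent_single (o : object T) : K o ->
  (exists w, ~ called_off P o w) ->
  exists w1 w2, [/\ ~ called_off P o w1, ~ called_off P o w2,
    value P o (P o) w1 <= P o & P o <= value P o (P o) w2].
Proof.
move=> Ko [w aw].
have gainE u : gain P (fun _ : 'I_1 => o) (fun=> 1) u = value P o (P o) u - P o.
  by rewrite /gain big_ord1 mul1r.
have [|w1 [w2 [[_ a1] [_ a2] _]]] :=
  hP (o := fun _ : 'I_1 => o) (fun=> 1) (fun=> Ko).
  by exists w, ord0.
rewrite !gainE subr_le0 subr_ge0 => /andP[g1 g2].
by exists w1, w2; split.
Qed.

(** Coherence disregards the cases where all the bets are called off; a bet
    that stands everywhere rules them out, and an inequality on the gain can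
    then be refuted by going through all cases. *)
Lemma coherent_no_sure_win3 (o1 o2 o3 : object T) (s1 s2 s3 : R) (w0 : T) :
  K o1 -> K o2 -> K o3 -> (forall w, ~ called_off P o1 w) ->
  exists w, s1 * (value P o1 (P o1) w - P o1)
          + s2 * (value P o2 (P o2) w - P o2)
          + s3 * (value P o3 (P o3) w - P o3) <= 0.
Proof.
move=> K1 K2 K3 a1.
pose o (i : 'I_3) := nth o1 [:: o1; o2; o3] i.
pose s (i : 'I_3) := nth 0 [:: s1; s2; s3] i.
have Ko i : K (o i) by case: i => -[|[|[|]]].
have [|w [_ [_ _ _ /andP[gw _]]]] := hP s Ko.
  by exists w0, ord0; apply: a1.
by exists w; move: gw; rewrite /gain !big_ord_recl big_ord0 addr0 addrA.
Qed.

Lemma cond_event_value (E H : event T) mu w :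
  value P (Conj [:: CondEvent E H]) mu w =
    if H w then (if E w then 1 else 0) else mu.
Proof. by rewrite /= /conj_value /=; case: (E w); case: (H w). Qed.

Lemma cond_event_not_called_off (E H : event T) w :
  H w -> ~ called_off P (Conj [:: CondEvent E H]) w.
Proof.
move=> Hw /(_ 2); rewrite cond_event_value Hw.
by case: ifP => _ ?; lra.
Qed.

Lemma cond_event_prevision_itv (E H : event T) :
  K (Conj [:: CondEvent E H]) -> possible H ->
  0 <= P (Conj [:: CondEvent E H]) <= 1.
Proof.
move=> KEH [w Hw]; set p := P _.
have [|w1 [w2 [a1 a2]]] := coherent_single KEH.
  by exists w; apply: cond_event_not_called_off.
have stands u : ~ called_off P (Conj [:: CondEvent E H]) u -> H u.
  by move=> au; case Hu: (H u) => //; case: au => mu; rewrite cond_event_value Hu.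
rewrite !cond_event_value (stands _ a1) (stands _ a2) -/p.
by case: ifP => _; case: ifP => _; lra.
Qed.

Section IteratedConditional.
Context (A C : event T).
Let x := P (Conj [:: CondEvent C A]).
Let iter := Iter (of_event A) [:: CondEvent C A; of_event C].
Context (hAC : possible (predI A C)) (hI : K iter).

Lemma iter_not_called_off w : A w -> C w -> ~ called_off P iter w.
Proof.
by move=> Aw Cw /(_ 0); rewrite iter_cond_event_value Aw Cw; apply/eqP/oner_neq0.
Qed.

Lemma iter_single : exists w1 w2, [/\ ~ called_off P iter w1,
  ~ called_off P iter w2, value P iter (P iter) w1 <= P iter
  & P iter <= value P iter (P iter) w2].
Proof.
case: hAC => w /andP[Aw Cw]; apply: coherent_single => //.
by exists w; apply: iter_not_called_off.
Qed.

Lemma iter_called_off_notC w : ~~ C w -> called_off P iter w.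
Proof. by move=> /negbTE Cw mu; rewrite iter_cond_event_value Cw. Qed.

(** For [x = 0] the value [mu (1 - x)] on [~A C] is the paid amount itself, so
    the bet stands on [AC] only, where its value is [1]. *)
Lemma iter_prevision_eq1 : x = 0 -> P iter = 1.
Proof.
move=> x0.
have stands u : ~ called_off P iter u -> A u && C u.
  move=> au; apply: contra_notT au; rewrite negb_and => /orP[Au|]; last first.
    exact: iter_called_off_notC.
  by move=> mu; rewrite iter_cond_event_value -/x x0 (negbTE Au) subr0 mulr1 !if_same.
have [w1 [w2 [/stands/andP[A1 C1] /stands/andP[A2 C2]]]] := iter_single.
rewrite !iter_cond_event_value A1 C1 A2 C2 => le1 le2.
by apply/eqP; rewrite eq_le le1 le2.
Qed.

(** A negative prevision [mu] would be exceeded both by [1] on [AC] and by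
    [mu (1 - x)] on [~A C], and the bet is called off elsewhere. *)
Lemma iter_prevision_ge0 : 0 < x -> 0 <= P iter.
Proof.
move=> x_gt0; have [w [_ [aw _ + _]]] := iter_single.
have Cw : C w by apply: contra_notT aw; apply: iter_called_off_notC.
rewrite iter_cond_event_value Cw -/x.
case: ifP => _ le_mu; first exact: le_trans ler01 le_mu.
by rewrite -(pmulr_rge0 _ x_gt0); lra.
Qed.

End IteratedConditional.
End Coherence.

Theorem theorem11 (R : realType) (T : Type) (A C : event T)
    (K : object T -> Prop) (P : object T -> R)
    (hAC : possible (predI A C))
    (hP : coherent K P)
    (hA : K (Conj [:: of_event A]))
    (hCA : K (Conj [:: CondEvent C A]))
    (hI : K (Iter (of_event A) [:: CondEvent C A; of_event C])) :
  P (Iter (of_event A) [:: CondEvent C A; of_event C]) >= P (Conj [:: of_event A]).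
Proof.
have [w0 /andP[Aw0 Cw0]] := hAC.
have /andP[a_ge0 a_le1] : 0 <= P (Conj [:: of_event A]) <= 1.
  by apply: (cond_event_prevision_itv hP hA); exists w0.
have /andP[x_ge0 x_le1] : 0 <= P (Conj [:: CondEvent C A]) <= 1.
  by apply: (cond_event_prevision_itv hP hCA); exists w0.
have [x0|x_neq0] := eqVneq (P (Conj [:: CondEvent C A])) 0.
  by rewrite (iter_prevision_eq1 hP hAC hI x0).
have x_gt0 : 0 < P (Conj [:: CondEvent C A]) by rewrite lt_def x_neq0.
have mu_ge0 := iter_prevision_ge0 hP hAC hI x_gt0.
rewrite leNgt; apply/negP.
have A_stands w : ~ called_off P (Conj [:: of_event A]) w.
  exact: cond_event_not_called_off.
(* With these stakes the gain is [x (a - mu)] on [A] and on [~A C], and [x a]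
   on [~A ~C]. *)
have [w] := coherent_no_sure_win3 hP (- P (Conj [:: CondEvent C A]))
  (- (1 - P (Iter (of_event A) [:: CondEvent C A; of_event C]))) 1 w0
  hA hCA hI A_stands.
rewrite iter_cond_event_value !cond_event_value /sure.
move: (P (Conj [:: of_event A])) (P (Conj [:: CondEvent C A]))
  (P (Iter _ _)) x_gt0 mu_ge0 => a x mu x_gt0 mu_ge0 + mu_lt_a.
have : 0 < x * (a - mu) by rewrite mulr_gt0 ?subr_gt0.
have : 0 <= x * mu by rewrite mulr_ge0 // ltW.
by case: (A w); case: (C w) => /= xmu_ge0 win_gt0 loss; lra.
Qed.
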